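(* The expected competitive ratio $\mathbf{E}[\mathsf{r}]=\mathbf{E}\left[\mathcal{S}_{on}/\mathcal{S}_{\mathrm{off}}\right]$ of the Accumulate&Dump algorithm (described in the context) is finite.
   Context: Model. Time is divided into slots of length $w>0$. At the beginning of slot $i$ ($i=0,1,2,\dots$) an amount $\mathcal{E}_i$ of energy arrives at a transmitter with battery capacity $\mathcal{C}_t>0$. The $\mathcal{E}_i$ are i.i.d. with probability density function $f$, where $f(x)=0$ for $x<0$ and for $x>\mathcal{C}_t$. The receiver has a conventional power source (always able to be on). Energy stored in the battery can never exceed $\mathcal{C}_t$. With transmit power $p$, bits are sent at rate $g(p)$, where $g:[0,\infty)\to[0,\infty)$ is monotonically increasing, $g(0)=0$, $\lim_{p\to\infty}g(p)=\infty$, $g$ is concave, and $g(p)/p$ is convex and monotonically decreasing with limit $0$ as $p\to\infty$. The goal is to transmit $B_0>0$ bits in minimum time. The online algorithm knows $f$ but sees the realizations only causally. Algorithm Accumulate&Dump, with constant parameter $c\ge1$. Starting from an empty battery, wait for $\mathcal{N}$ slots, where $\mathcal{N}=\min\{n:\sum_{i=0}^{n-1}\mathcal{E}_i\ge \mathcal{C}_t/c\}$, and then, within the $\mathcal{N}$-th slot, use all the energy available in the battery at constant rate during time $w$. The battery is then empty; repeat the same procedure afresh with the subsequent arrivals, until $B_0$ bits have been transmitted. $\mathcal{S}_{on}$ is the number of slots taken by Accumulate&Dump to transmit $B_0$ bits, and $\mathcal{S}_{\mathrm{off}}$ is the number of slots taken by an optimal offline algorithm (which knows all arrivals in advance and is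 subject to the same battery capacity). *)

(* Defs.v *)
From HB Require Import structures.
From mathcomp Require Import all_boot all_order all_algebra.
From mathcomp Require Import all_classical all_reals all_analysis.

Set Implicit Arguments.
Unset Strict Implicit.
Unset Printing Implicit Defensive.

Import Order.TTheory GRing.Theory Num.Theory.
Import numFieldNormedType.Exports.

Local Open Scope classical_set_scope.
Local Open Scope ring_scope.

(* The values of [g] at negative powers are irrelevant and unconstrained. *)
Record rate_function (R : realType) (g : R -> R) : Prop := RateFunction {
  rate_ge0 : forall p, 0 <= p -> 0 <= g p ;
  rate_increasing : {in `[0, +oo[ &, {homo g : p q / p <= q}} ;
  rate0 : g 0 = 0 ;
  rate_cvg_pinfty : g p @[p --> +oo] --> +oo ;
  rate_concave : convex_function (`[0, +oo[%classic : set R^o) (fun p => - g p) ;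
  rate_div_convex :
    convex_function (`]0, +oo[%classic : set R^o) (fun p => g p / p) ;
  rate_div_decreasing :
    {in `]0, +oo[ &, {homo (fun p => g p / p) : p q / p <= q >-> q <= p}} ;
  rate_div_cvg0 : g p / p @[p --> +oo] --> 0 }.

(* [f] is a Lebesgue probability density of the law of [X]; that its total
   integral is 1 follows by taking [A := setT]. *)
Definition has_density d (T : measurableType d) (R : realType)
    (P : probability T R) (X : {RV P >-> R}) (f : R -> R) : Prop :=
  [/\ measurable_fun setT f, (forall x, 0 <= f x) &
      forall A : set R, measurable A ->
        distribution P X A =
        (\int[@lebesgue_measure R]_(x in A) (f x)%:E)%E].

Definition mutually_independent d (T : measurableType d) (R : realType)
    (P : probability T R) (X : nat -> {RV P >-> R}) : Prop :=
  forall (J : seq nat) (A : nat -> set R), uniq J ->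
    (forall j, measurable (A j)) ->
    P (\bigcap_(j in [set` J]) (X j @^-1` A j)) =
    (\prod_(j <- J) P (X j @^-1` A j))%E.

Section transmission.
Variables (R : realType) (w Ct B0 : R) (g : R -> R).

Local Notation mu := (@lebesgue_measure R).

(* Slot [i] is the time interval [i w, (i + 1) w]; a transmission strategy is
   given by its power profile [p], [p t] being the transmit power at time [t]. *)
Definition slot (i : nat) : set R := `[i%:R * w, i.+1%:R * w].

Definition bits (p : R -> R) (t : R) : \bar R :=
  (\int[mu]_(s in `[0%R, t]) (g (p s))%:E)%E.

(* The infimum of the empty set is +oo, so that a profile which never delivers
   the [B0] bits has completion time +oo. *)
Definition completion_time (p : R -> R) : \bar R :=
  ereal_inf [set t%:E | t in [set t | 0 <= t /\ (B0%:E <= bits p t)%E]].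

(* The number of slots (the last one possibly incomplete) spanned by a
   duration, i.e. the ceiling of [t / w]. *)
Definition nb_slots (t : \bar R) : \bar R :=
  ereal_inf [set n%:R%:E | n in [set n : nat | (t <= (n%:R * w)%:E)%E]].

(* The energy in an initially empty battery just after the [i]-th arrival, when
   [e j] is spent during slot [j]; energy above the capacity is lost. *)
Fixpoint battery (E e : nat -> R) (i : nat) : R :=
  match i with
  | 0 => Num.min Ct (E 0%N)
  | j.+1 => Num.min Ct (battery E e j - e j + E j.+1)
  end.

(* Energy arrives only at the beginning of slots, so the energy constraint
   holds at every time of slot [i] iff it holds at the end of that slot. *)
Definition feasible (E : nat -> R) (p : R -> R) : Prop :=
  [/\ measurable_fun setT p, (forall t, 0 <= p t),
      (forall i, mu.-integrable (slot i) (EFin \o p)) &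
      forall i, \int[mu]_(t in slot i) p t <=
                battery E (fun j => \int[mu]_(t in slot j) p t) i].

(* The whole arrival sequence [E] is known to the offline algorithm, which
   minimises the transmission time over all feasible profiles. *)
Definition offline_time (E : nat -> R) : \bar R :=
  ereal_inf [set completion_time p | p in feasible E].

Definition S_off (E : nat -> R) : \bar R := nb_slots (offline_time E).

Variable c : R.

(* [ad_start E i] is the first slot of the accumulation phase which contains
   slot [i]. With [s := ad_start E i], slot [i] ends its phase iff
   E_s + ... + E_i >= Ct / c; since a phase stops the first time this holds, its
   number of slots is min {n | E_s + ... + E_(s + n - 1) >= Ct / c}. *)
Fixpoint ad_start (E : nat -> R) (i : nat) : nat :=
  match i with
  | 0 => 0%N
  | j.+1 =>
    if Ct / c <= \sum_(ad_start E j <= k < j.+1) E k then j.+1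
    else ad_start E j
  end.

Definition ad_energy (E : nat -> R) (i : nat) : R :=
  let s := \sum_(ad_start E i <= k < i.+1) E k in
  if Ct / c <= s then Num.min Ct s else 0.

(* [Num.truncn (t / w)] is the index of the slot containing the time [t]. *)
Definition ad_power (E : nat -> R) (t : R) : R :=
  ad_energy E (Num.truncn (t / w)) / w.

Definition S_on (E : nat -> R) : \bar R :=
  nb_slots (completion_time (ad_power E)).

End transmission.

(* Main.v *)
Require Import Defs.
From HB Require Import structures.
From mathcomp Require Import all_boot all_order all_algebra.
From mathcomp Require Import all_classical all_reals all_analysis measurable_realfun.
From mathcomp Require Import ring lra.

Set Implicit Arguments.
Unset Strict Implicit.
Unset Printing Implicit Defensive.

Import Order.TTheory GRing.Theory Num.Theory.
Import numFieldNormedType.Exports.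

Local Open Scope classical_set_scope.
Local Open Scope ring_scope.

(* Every offline strategy needs at least one slot, because the bits sent in time
   [eps] with energy at most [Ct] are at most [eps * g (Ct / eps)], which tends
   to 0 with [eps]; so the ratio is at most [S_on]. A phase consumes at most
   [2 * Ct] and sends at least [w * g (Ct / c / w)] bits, hence [S_on <= n] as
   soon as a fixed amount [M] of energy has arrived before slot [n]. A density
   has no atom, so an arrival is at least some [delta > 0] with positive
   probability. Lay the slots out in rows of length [K >= M / delta]: if each of
   the [K] columns contains such an arrival within the first [j] rows, then [M]
   has arrived. A given column fails with probability [rho ^ j], so [S_on] has
   exponential tails.

   Integrability also requires that [S_off] be measurable, for arbitrary (even
   negative) arrivals. By Jensen's inequality constant power is optimal within a
   slot, which reduces profiles to sequences of energies per slot. Lowering the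
   energies preserves feasibility, and rational sequences suffice up to a factor
   close to 1; Tychonoff's theorem recovers an exact solution. As [g] may jump at
   0, the rational sequences are required to be 0 or bounded away from 0. *)

(** * Concavity estimates for the rate function *)

Section rate.
Context {R : realType} {g : R -> R}.
Hypothesis g_rate : rate_function g.

Lemma rate_le p q : 0 <= p -> p <= q -> g p <= g q.
Proof.
move=> p0 pq; apply: (rate_increasing g_rate) => //; rewrite in_itv/= andbT//.
exact: le_trans pq.
Qed.

Lemma rate_concavity x y t : 0 <= x -> 0 <= y -> 0 <= t <= 1 ->
  t * g x + (1 - t) * g y <= g (t * x + (1 - t) * y).
Proof.
move=> x0 y0 /andP[t0 t1].
have := rate_concave g_rate (Itv01 t0 t1).
move=> /(_ x y); rewrite !inE/= !in_itv/= !andbT => /(_ x0 y0).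
rewrite [X in - g X](_ : _ = t * x + (1 - t) * y)//.
rewrite [X in _ <= X](_ : _ = t * - g x + (1 - t) * - g y)//.
by rewrite !mulrN -opprD lerN2.
Qed.

Lemma rate_scale t x : 0 <= t <= 1 -> 0 <= x -> t * g x <= g (t * x).
Proof.
move=> t01 x0; have := rate_concavity x0 (lexx 0) t01.
by rewrite (rate0 g_rate) !mulr0 !addr0.
Qed.

(** Unboundedness gives some [q >= p] with [g q > 0], and the chord from the origin to [q] lies
    below the graph at [p]. *)
Lemma rate_gt0 p : 0 < p -> 0 < g p.
Proof.
move=> p0; have [q [pq gq]] : exists q, p <= q /\ 0 < g q.
  have /cvgryPgt/(_ 0)[M [_ HM]] := rate_cvg_pinfty g_rate.
  exists (Num.max p (M + 1)); split; first by rewrite le_max lexx.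
  by apply: HM; rewrite lt_max ltrDl ltr01 orbT.
have q0 : 0 < q by exact: lt_le_trans pq.
apply: (@lt_le_trans _ _ (p / q * g q)); first by rewrite mulr_gt0// divr_gt0.
rewrite -[leRHS](_ : g (p / q * q) = _); last by rewrite divfK// gt_eqF.
apply: rate_scale; last exact: ltW.
by rewrite ler_pdivrMr// mul1r pq andbT divr_ge0// ltW.
Qed.

(** The slope [s] is the supremum of the slopes to the right of [q], all bounded by the slopes to
    its left. Nonnegative slope and intercept let the line be integrated term by term. *)
Lemma rate_support q : 0 < q -> exists s, [/\ 0 <= s, 0 <= g q - s * q &
  forall x, 0 <= x -> g x <= g q - s * q + s * x].
Proof.
move=> q0; pose S := [set (g y - g q) / (y - q) | y in [set y | q < y]].
have slope x y : 0 <= x -> x < q -> q < y ->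
    (g y - g q) / (y - q) <= (g q - g x) / (q - x).
  move=> x0 xq qy.
  have yx : 0 < y - x by rewrite subr_gt0 (lt_trans xq).
  have qx : 0 < q - x by rewrite subr_gt0.
  have yq : 0 < y - q by rewrite subr_gt0.
  have y0 : 0 <= y by rewrite ltW// (le_lt_trans x0)// (lt_trans xq).
  have t01 : 0 <= (y - q) / (y - x) <= 1.
    rewrite ler_pdivrMr// mul1r divr_ge0 ?ltW//=; lra.
  have := rate_concavity x0 y0 t01.
  have -> : 1 - (y - q) / (y - x) = (q - x) / (y - x).
    by field; rewrite gt_eqF.
  have -> : (y - q) / (y - x) * x + (q - x) / (y - x) * y = q.
    by field; rewrite gt_eqF.
  rewrite mulrAC [X in _ + X]mulrAC -mulrDl ler_pdivrMr// => H.
  rewrite ler_pdivrMr// mulrAC ler_pdivlMr//; nra.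
have S0 : S !=set0.
  by exists ((g (q + 1) - g q) / (q + 1 - q)), (q + 1) => //=; rewrite ltrDl.
have ubS x : 0 <= x -> x < q -> ubound S ((g q - g x) / (q - x)).
  by move=> x0 xq _ [y qy <-]; exact: slope.
have hS : has_sup S.
  by split => //; exists ((g q - g 0) / (q - 0)); exact: ubS.
exists (sup S); split.
- apply: le_trans (ub_le_sup hS.2 _); last first.
    by exists (q + 1) => //=; rewrite ltrDl.
  rewrite divr_ge0//; last by rewrite addrAC subrr add0r.
  by rewrite subr_ge0 rate_le ?lerDl// ltW.
- rewrite subr_ge0 -ler_pdivlMr//; apply: ge_sup => //.
  by have := ubS 0 (lexx 0) q0; rewrite (rate0 g_rate) !subr0.
- move=> x x0; case: (ltgtP x q) => [xq|qx|->].
  + have : sup S <= (g q - g x) / (q - x) by apply: ge_sup => //; exact: ubS.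
    by rewrite ler_pdivlMr ?subr_gt0//; lra.
  + have : (g x - g q) / (x - q) <= sup S.
      by apply: ub_le_sup; [exact: hS.2|exists x].
    by rewrite ler_pdivrMr ?subr_gt0//; lra.
  + by rewrite subrK.
Qed.

Lemma measurable_rate_comp d (T : measurableType d) (h : T -> R) :
  measurable_fun setT h -> (forall x, 0 <= h x) ->
  measurable_fun setT (fun x => g (h x)).
Proof.
(* Negative powers are unconstrained, so the argument is cut off at 0 to obtain a function monotone
   on the whole line. *)
move=> mh h0; have -> : (fun x => g (h x)) = (fun y => g (Num.max 0 y)) \o h.
  by apply/funext => x /=; rewrite max_r.
apply: measurableT_comp => //; apply: nondecreasing_measurable => // x y xy.
by apply: rate_le; [rewrite le_max lexx|rewrite ge_max !le_max lexx xy orbT].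
Qed.

End rate.

(** * Integrals over slots and their pieces *)

Section intervals.
Context {R : realType}.
Local Notation mu := (@lebesgue_measure R).

Lemma lebesgue_measure_cc (a b : R) : a <= b -> mu `[a, b] = (b - a)%:E.
Proof.
move=> ab; rewrite lebesgue_measure_itv/= lte_fin.
case: ltP => // ba; have -> : a = b by apply/eqP; rewrite eq_le ab ba.
by rewrite subrr.
Qed.

(** The value is prescribed on the half-open interval only, since slotwise profiles switch at the
    right end, which has measure 0. *)
Lemma integral_itv_cst (a b r : R) (h : R -> \bar R) : a <= b ->
  measurable_fun setT h -> (forall t, a <= t < b -> h t = r%:E) ->
  (\int[mu]_(t in `[a, b]) h t = (r * (b - a))%:E)%E.
Proof.
move=> ab mh hr.
rewrite -integral_itv_bndo_bndc; last exact: measurable_funTS.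
rewrite (eq_integral (cst r%:E)); last first.
  by move=> t; rewrite inE/= in_itv/= => /hr.
rewrite integral_itv_bndo_bndc//.
by rewrite integral_cst// [X in (_ * X)%E](lebesgue_measure_cc ab) EFinM.
Qed.

Lemma integral_itv_split (a b c : R) (h : R -> \bar R) : a <= b <= c ->
  measurable_fun setT h -> (forall t, 0 <= h t)%E ->
  (\int[mu]_(t in `[a, c]) h t =
   \int[mu]_(t in `[a, b]) h t + \int[mu]_(t in `[b, c]) h t)%E.
Proof.
move=> /andP[ab bc] mh h0.
rewrite -[in X in (_ + X)%E]integral_itv_obnd_cbnd; last exact: measurable_funTS.
rewrite -ge0_integral_setU//; last 2 first.
- exact: measurable_funTS.
- apply/disj_setPS => t [/=]; rewrite !in_itv/= => /andP[_ tb] /andP[bt _].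
  by have := lt_le_trans bt tb; rewrite ltxx.
by rewrite -itv_bndbnd_setU// bnd_simp.
Qed.

Lemma integral_slots (w : R) (n : nat) (eps : R) (h : R -> \bar R) :
  0 <= w -> 0 <= eps ->
  measurable_fun setT h -> (forall t, 0 <= h t)%E ->
  (\int[mu]_(t in `[0%R, (n%:R * w + eps)%R]) h t =
   \sum_(i < n) \int[mu]_(t in slot w i) h t +
   \int[mu]_(t in `[(n%:R * w)%R, (n%:R * w + eps)%R]) h t)%E.
Proof.
move=> w0 eps0 mh h0; elim: n eps eps0 => [|n IH] eps eps0.
  by rewrite big_ord0 mul0r add0r add0e.
have nw : n.+1%:R * w = n%:R * w + w by rewrite -natr1 mulrDl mul1r.
rewrite {1}nw -addrA IH ?addr_ge0// big_ord_recr/= -addeA; congr (_ + _)%E.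
rewrite (@integral_itv_split _ (n.+1%:R * w))//; last first.
  by rewrite nw lerDl w0 addrA lerDl eps0.
by rewrite /slot nw (addrA (n%:R * w)).
Qed.

End intervals.

(** * Jensen's inequality for the bits sent in an interval *)

Section jensen.
Context {R : realType} {g : R -> R}.
Hypothesis g_rate : rate_function g.
Local Notation mu := (@lebesgue_measure R).

(* Integrate the supporting line of the concave [g] at the mean of [p]; at mean
   [0], where [g] may jump, [p] vanishes almost everywhere. *)
Lemma integral_rate_le (a L : R) (p : R -> R) : 0 < L ->
  measurable_fun setT p -> (forall t, 0 <= p t) ->
  mu.-integrable `[a, a + L] (EFin \o p) ->
  (\int[mu]_(t in `[a, (a + L)%R]) (g (p t))%:E <=
   (L * g ((\int[mu]_(t in `[a, a + L]) p t) / L))%:E)%E.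
Proof.
move=> L0 mp p0 ip.
have mgp : measurable_fun setT (fun t => (g (p t))%:E).
  by apply/measurable_EFinP; exact: measurable_rate_comp.
have Ep : (\int[mu]_(t in `[a, (a + L)%R]) (p t)%:E =
    (\int[mu]_(t in `[a, a + L]) p t)%:E)%E.
  by rewrite fineK//; exact: integrable_fin_num.
have E0 : 0 <= \int[mu]_(t in `[a, a + L]) p t by exact: Rintegral_ge0.
move: E0; rewrite le_eqVlt => /orP[/eqP E0|E0].
  rewrite -E0 mul0r (rate0 g_rate) mulr0.
  have : (\int[mu]_(t in `[a, (a + L)%R]) `|(p t)%:E| = 0)%E.
    rewrite [RHS](_ : _ = (\int[mu]_(t in `[a, a + L]) p t)%:E); last first.
      by rewrite -E0.
    rewrite -Ep; apply: eq_integral => t _.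
    by rewrite gee0_abs// lee_fin.
  move=> pE0; have mpE : measurable_fun `[a, a + L] (EFin \o p).
    by apply: measurable_funTS; exact/measurable_EFinP.
  have [+ _] := ae_eq_integral_abs mu (measurable_itv `[a, a + L]) mpE.
  move=> /(_ pE0) pae.
  rewrite (@ge0_ae_eq_integral _ _ _ _ _ _ (cst 0%E))//.
  - by rewrite integral0.
  - exact: measurable_funTS.
  - by move=> t _; rewrite lee_fin (rate_ge0 g_rate).
  - apply: filterS pae => t /= pt /pt[->].
    by rewrite (rate0 g_rate).
have q0 : 0 < (\int[mu]_(t in `[a, a + L]) p t) / L by rewrite divr_gt0.
have [s [s0 b0 sup]] := rate_support g_rate q0.
set e := \int[mu]_(t in _) _ in Ep E0 q0 b0 sup *.
apply: (@le_trans _ _ (\int[mu]_(t in `[a, (a + L)%R])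
    ((g (e / L) - s * (e / L))%:E + s%:E * (p t)%:E))%E).
  apply: ge0_le_integral => //.
  - by move=> t _; rewrite lee_fin (rate_ge0 g_rate).
  - exact: measurable_funTS.
  - apply: measurable_funTS; apply/measurable_EFinP.
    by apply: measurable_funD => //; exact: measurable_funM.
  - by move=> t _; rewrite -EFinM -EFinD lee_fin sup.
rewrite ge0_integralD//; last 2 first.
- by move=> t _; rewrite -EFinM lee_fin mulr_ge0.
- apply: measurable_funTS; apply/measurable_EFinP.
  exact: measurable_funM.
rewrite ge0_integralZl_EFin//; last 2 first.
- by move=> t _; rewrite lee_fin.
- by apply: measurable_funTS; exact/measurable_EFinP.
rewrite Ep integral_cst//= [X in (_ * X + _)%E]lebesgue_measure_cc ?lerDl ?(ltW L0)//.
rewrite -!EFinM -EFinD lee_fin addrAC subrr add0r le_eqVlt; apply/orP; left.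
by apply/eqP; field; rewrite gt_eqF.
Qed.

End jensen.

(* The bits sent when slot [i < n] spends the energy [e i], and the first [eps]
   time units of slot [n] spend [e n], each at constant power. *)
Definition throughput (R : realType) (w : R) (g : R -> R) (n : nat) (eps : R)
    (e : nat -> R) : R :=
  \sum_(i < n) w * g (e i / w) + eps * g (e n / eps).

(** * Slot counts, completion times and bits of slotwise profiles *)

Section slots.
Context {R : realType}.
Variables (w : R).
Hypothesis w_gt0 : 0 < w.
Local Notation mu := (@lebesgue_measure R).

Lemma truncn_slot (i : nat) (t : R) :
  i%:R * w <= t < i.+1%:R * w -> Num.truncn (t / w) = i.
Proof.
by move=> /andP[it ti]; apply: truncn_def; rewrite ler_pdivlMr// it ltr_pdivrMr.
Qed.

Lemma measurable_slotwise (u : nat -> R) :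
  measurable_fun setT (fun t : R => u (Num.truncn (t / w))).
Proof.
have mtr : measurable_fun setT (fun t : R => (Num.truncn t)%:R : R).
  apply: nondecreasing_measurable => // x y xy.
  by rewrite ler_nat le_truncn.
have mt : measurable_fun setT (@Num.truncn R).
  move=> _ A _; rewrite setTI.
  have -> : @Num.truncn R @^-1` A =
      \bigcup_(n in A) ((fun t : R => (Num.truncn t)%:R) @^-1` [set n%:R : R]).
    apply/seteqP; split => [x/= Ax|x [n An/= /eqP]]; first by exists (Num.truncn x).
    by rewrite eqr_nat => /eqP ->.
  apply: bigcup_measurable => n _.
  by rewrite -[_ @^-1` _]setTI; exact: mtr.
apply: (measurableT_comp (f := u)) => //.
by apply: (measurableT_comp mt); exact: mulrr_measurable.
Qed.

(** If [t] exceeds [n%:R * w], every admissible count is at least [n.+1], and so is the infimum. *)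
Lemma nb_slots_le (t : \bar R) (n : nat) :
  (nb_slots w t <= n%:R%:E)%E <-> (t <= (n%:R * w)%:E)%E.
Proof.
split => [h|tn]; last by apply: ereal_inf_lbound; exists n.
rewrite leNgt; apply/negP => nt.
have : (n.+1%:R%:E <= nb_slots w t)%E.
  apply: le_ereal_inf_tmp => _ [m /= tm <-].
  have := lt_le_trans nt tm; rewrite lte_fin ltr_pM2r// ltr_nat => nm.
  by rewrite lee_fin ler_nat.
by move=> /le_trans/(_ h); rewrite lee_fin ler_nat ltnn.
Qed.

Lemma ereal_le_slots (x : \bar R) (n : nat) :
  (forall k : nat, x <= (n%:R * w + w / k.+1%:R)%:E)%E -> (x <= (n%:R * w)%:E)%E.
Proof.
move=> h; apply/lee_addgt0Pr => e e0.
apply: le_trans (h (Num.truncn (w / e))) _.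
rewrite -EFinD lee_fin lerD2l ler_pdivrMr// mulrC -ler_pdivrMr// ltW//.
exact: truncnS_gt.
Qed.

Context {g : R -> R}.
Hypothesis g_rate : rate_function g.
Variable B0 : R.

Lemma le_bits (p : R -> R) (s t : R) : measurable_fun setT p ->
  (forall t, 0 <= p t) -> s <= t -> (bits g p s <= bits g p t)%E.
Proof.
move=> mp p0 st; apply: ge0_subset_integral => //.
- apply: measurable_funTS; apply/measurable_EFinP.
  exact: measurable_rate_comp.
- by move=> x _; rewrite lee_fin (rate_ge0 g_rate).
- by apply: subset_itvl; rewrite bnd_simp.
Qed.

(** Neither infimum need be attained, so delivery is asked only with the slack [w / k.+1%:R];
    countably many slacks suffice, which later gives measurability. A singleton [S] covers the
    online algorithm. *)
Lemma completion_times_le (S : set (R -> R)) (n : nat) :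
  (forall p, S p -> measurable_fun setT p) -> (forall p, S p -> forall t, 0 <= p t) ->
  (ereal_inf [set completion_time B0 g p | p in S] <= (n%:R * w)%:E)%E <->
  forall k : nat, exists2 p, S p & (B0%:E <= bits g p (n%:R * w + w / k.+1%:R))%E.
Proof.
move=> mS S0; split => [h k|h].
  have k0 : 0 < w / k.+1%:R by rewrite divr_gt0.
  have /ereal_inf_lt[_ [p Sp <-]] : (ereal_inf [set completion_time B0 g p | p in S] <
      (n%:R * w + w / k.+1%:R)%:E)%E.
    by apply: le_lt_trans h _; rewrite lte_fin ltrDl.
  move=> /ereal_inf_lt[_ [t [t0 Bt] <-]]; rewrite lte_fin => tk.
  exists p => //; apply: le_trans Bt _.
  by apply: le_bits; [exact: mS|exact: S0|exact: ltW].
apply: ereal_le_slots => k; have [p Sp Bp] := h k.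
apply: ge_ereal_inf; exists (completion_time B0 g p); first by exists p.
apply: ereal_inf_lbound; exists (n%:R * w + w / k.+1%:R) => //; split => //.
by rewrite addr_ge0// ?mulr_ge0 ?divr_ge0// ltW.
Qed.

Lemma bits_step (n : nat) (eps : R) (p : R -> R) (u : nat -> R) : 0 <= eps ->
  measurable_fun setT p -> (forall t, 0 <= p t) ->
  (forall i t, (i < n)%N -> i%:R * w <= t < i.+1%:R * w -> p t = u i) ->
  (forall t, n%:R * w <= t < n%:R * w + eps -> p t = u n) ->
  bits g p (n%:R * w + eps) = (\sum_(i < n) w * g (u i) + eps * g (u n))%:E.
Proof.
move=> eps0 mp p0 pu pn.
have mgp : measurable_fun setT (fun t => (g (p t))%:E).
  by apply/measurable_EFinP; exact: measurable_rate_comp.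
rewrite /bits integral_slots ?(ltW w_gt0)//; last first.
  by move=> t; rewrite lee_fin (rate_ge0 g_rate).
rewrite EFinD -sumEFin; congr (_ + _)%E.
  apply: eq_bigr => i _; rewrite /slot (@integral_itv_cst _ _ _ (g (u i)))//.
  - by rewrite -natr1 mulrDl mul1r addrAC subrr add0r mulrC.
  - by rewrite ler_pM2r// ler_nat.
  - by move=> t /(pu _ _ (ltn_ord i)) ->.
rewrite (@integral_itv_cst _ _ _ (g (u n))) ?lerDl//; last by move=> t /pn ->.
by rewrite addrAC subrr add0r mulrC.
Qed.

Lemma bits_le_throughput (n : nat) (eps : R) (p : R -> R) (e : nat -> R) : 0 < eps ->
  measurable_fun setT p -> (forall t, 0 <= p t) ->
  (forall i, mu.-integrable (slot w i) (EFin \o p)) -> eps <= w ->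
  (forall i, (i < n)%N -> e i = \int[mu]_(t in slot w i) p t) ->
  e n = \int[mu]_(t in `[n%:R * w, n%:R * w + eps]) p t ->
  (bits g p (n%:R * w + eps) <= (throughput w g n eps e)%:E)%E.
Proof.
move=> eps0 mp p0 ip epsw ei en.
have mgp : measurable_fun setT (fun t => (g (p t))%:E).
  by apply/measurable_EFinP; exact: measurable_rate_comp.
rewrite /bits integral_slots ?(ltW w_gt0) ?(ltW eps0)//; last first.
  by move=> t; rewrite lee_fin (rate_ge0 g_rate).
rewrite EFinD -sumEFin; apply: leeD.
  apply: lee_sum => i _; rewrite ei//.
  have := ip i; rewrite /slot -natr1 mulrDl mul1r => ipi.
  exact: integral_rate_le.
rewrite en; apply: integral_rate_le => //.
apply: integrableS (ip n) => //; first exact: measurable_itv.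
by apply: subset_itvl; rewrite bnd_simp -natr1 mulrDl mul1r lerD2l.
Qed.

End slots.

(** * Reduction of offline profiles to energies per slot *)

Section offline.
Context {R : realType}.
Variables (w Ct B0 : R) (g : R -> R).
Hypothesis w_gt0 : 0 < w.
Hypothesis g_rate : rate_function g.
Local Notation mu := (@lebesgue_measure R).

Definition schedulable (E e : nat -> R) : Prop :=
  forall i, 0 <= e i <= battery Ct E e i.

Lemma le_battery (E e e' : nat -> R) (i : nat) : (forall j, e' j <= e j) ->
  battery Ct E e i <= battery Ct E e' i.
Proof.
move=> ee'; elim: i => [|i IH] //=.
by rewrite le_min !ge_min lexx/= lerD2r lerB// orbT.
Qed.

Lemma battery_le_capacity (E e : nat -> R) (i : nat) : battery Ct E e i <= Ct.
Proof. by case: i => [|i] /=; rewrite ge_min lexx. Qed.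

(** Spending less leaves at least as much in the battery, so both sides of the constraint move
    favourably. *)
Lemma le_schedulable (E e e' : nat -> R) : (forall j, 0 <= e' j <= e j) ->
  schedulable E e -> schedulable E e'.
Proof.
move=> ee' Ee i; have /andP[-> e'i] := ee' i.
have /andP[_ ei] := Ee i; rewrite (le_trans e'i)// (le_trans ei)//.
by apply: le_battery => j; have /andP[] := ee' j.
Qed.

(** The profile for which Jensen's inequality is an equality on each piece. *)
Definition schedule_profile (n : nat) (eps : R) (e : nat -> R) (t : R) : R :=
  if t < n%:R * w then e (Num.truncn (t / w)) / w
  else if t < n%:R * w + eps then e n / eps else 0.

Section schedule_profile_theory.
Variables (n : nat) (eps : R) (e : nat -> R).
Hypothesis eps_gt0 : 0 < eps.
Hypothesis eps_le : eps <= w.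
Hypothesis e_ge0 : forall i, 0 <= e i.
Local Notation p := (schedule_profile n eps e).

Let measurable_p : measurable_fun setT p.
Proof.
apply: measurable_fun_ifT => //; first exact: measurable_fun_ltr.
  exact: (measurable_slotwise w (fun i => e i / w)).
by apply: measurable_fun_ifT => //; exact: measurable_fun_ltr.
Qed.

Let p_ge0 t : 0 <= p t.
Proof.
by rewrite /schedule_profile; do 2?case: ifP => // _; rewrite divr_ge0// ltW.
Qed.

Let p_slot i t : (i < n)%N -> i%:R * w <= t < i.+1%:R * w -> p t = e i / w.
Proof.
move=> in_ ti; rewrite /schedule_profile (truncn_slot w_gt0 ti) ifT//.
by move/andP: ti => [_ /lt_le_trans->//]; rewrite ler_pM2r// ler_nat.
Qed.

Let p_last t : n%:R * w <= t < n%:R * w + eps -> p t = e n / eps.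
Proof. by move=> /andP[nt tn]; rewrite /schedule_profile ltNge nt/= tn. Qed.

Let p_after t : n%:R * w + eps <= t -> p t = 0.
Proof.
move=> nt; rewrite /schedule_profile !ltNge nt/= (le_trans _ nt)//.
by rewrite lerDl ltW.
Qed.

Let slot_length i : i.+1%:R * w - i%:R * w = w.
Proof. by rewrite -natr1 mulrDl mul1r addrAC subrr add0r. Qed.

Let le_slot i j : (i <= j)%N -> i%:R * w <= j%:R * w.
Proof. by move=> ij; rewrite ler_pM2r// ler_nat. Qed.

Let mEp : measurable_fun setT (EFin \o p).
Proof. exact/measurable_EFinP. Qed.

Let integral_p i : (\int[mu]_(t in slot w i) (p t)%:E =
  (if (i <= n)%N then e i else 0)%:E)%E.
Proof.
rewrite /slot; case: (ltngtP i n) => [ltin|ltni|->].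
- rewrite (@integral_itv_cst _ _ _ (e i / w)) ?le_slot//.
    by rewrite slot_length divfK// gt_eqF.
  by move=> t /(p_slot ltin) ->.
- rewrite (@integral_itv_cst _ _ _ 0) ?le_slot ?mul0r//.
  move=> t /andP[ti _]; rewrite p_after//.
  rewrite (le_trans _ ti)// (@le_trans _ _ (n.+1%:R * w)) ?le_slot//.
  by rewrite -natr1 mulrDl mul1r lerD2l.
- rewrite (@integral_itv_split _ _ (n%:R * w + eps))//; last first.
    by rewrite lerDl (ltW eps_gt0)/= -natr1 mulrDl mul1r lerD2l.
  rewrite (@integral_itv_cst _ _ _ (e n / eps)) ?lerDl ?(ltW eps_gt0)//; last first.
    by move=> t /p_last ->.
  rewrite (@integral_itv_cst _ _ _ 0)//; last 2 first.
    by rewrite -natr1 mulrDl mul1r lerD2l.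
    by move=> t /andP[/p_after -> _].
  by rewrite mul0r adde0 addrAC subrr add0r divfK// gt_eqF.
Qed.

Lemma schedule_profile_feasible (E : nat -> R) :
  schedulable E e -> feasible w Ct E p.
Proof.
move=> Ee; have pE i : \int[mu]_(t in slot w i) p t = if (i <= n)%N then e i else 0.
  by rewrite /Rintegral integral_p.
split => // i.
- apply/integrableP; split; first exact: measurable_funTS.
  apply: le_lt_trans (ltry (if (i <= n)%N then e i else 0)); rewrite -integral_p.
  apply: ge0_le_integral => //.
  + exact: measurable_itv.
  + by apply: measurable_funTS; apply: measurableT_comp => //; exact: mEp.
  + exact: measurable_funTS mEp.
  + by move=> t _ /=; rewrite ger0_norm.
- rewrite pE.
  have -> : (fun j => \int[mu]_(t in slot w j) p t) =
      (fun j => if (j <= n)%N then e j else 0) by exact/funext.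
  (* Replacing the energies after slot [n] by 0 only lowers them. *)
  suff /(_ i)/andP[] : schedulable E (fun j => if (j <= n)%N then e j else 0) by [].
  by apply: le_schedulable Ee => j; case: ifP; rewrite ?e_ge0 lexx.
Qed.

Lemma bits_schedule_profile :
  bits g p (n%:R * w + eps) = (throughput w g n eps e)%:E.
Proof.
pose u i := e i / if (i < n)%N then w else eps.
rewrite (bits_step w_gt0 g_rate (u := u)) ?(ltW eps_gt0)//.
- rewrite /u ltnn; congr (_ + _)%:E.
  by apply: eq_bigr => i _; rewrite ltn_ord.
- by move=> i t ltin; rewrite /u ltin; exact: p_slot.
- by rewrite /u ltnn; exact: p_last.
Qed.

End schedule_profile_theory.

(** Forward, Jensen's inequality replaces a profile by its energies; backward, [schedule_profile]
    realises the energies with exactly that many bits. *)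
Lemma offline_bitsP (E : nat -> R) (n : nat) (eps : R) : 0 < eps <= w ->
  (exists2 p, feasible w Ct E p & (B0%:E <= bits g p (n%:R * w + eps))%E) <->
  (exists2 e, schedulable E e & B0 <= throughput w g n eps e).
Proof.
move=> /andP[eps0 epsw]; split => [[p [mp p0 ip pE] Bp]|[e Ee Be]].
  (* In slot [n] only the energy spent before the deadline counts. Truncation lowers the energies of
     [p], so they stay schedulable. *)
  pose e i := if (i < n)%N then \int[mu]_(t in slot w i) p t
    else if i == n then \int[mu]_(t in `[n%:R * w, n%:R * w + eps]) p t else 0.
  exists e; last first.
    rewrite -lee_fin (le_trans Bp)//; apply: bits_le_throughput => //.
    - by move=> i ltin; rewrite /e ltin.
    - by rewrite /e ltnn eqxx.
  apply: (@le_schedulable _ (fun i => \int[mu]_(t in slot w i) p t)) => i; last first.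
    by rewrite pE andbT Rintegral_ge0.
  rewrite /e; case: ltnP => _; first by rewrite lexx andbT Rintegral_ge0.
  case: eqP => [->|_]; last by rewrite lexx Rintegral_ge0.
  rewrite Rintegral_ge0//=.
  have sub : `[n%:R * w, n%:R * w + eps] `<=` slot w n.
    by apply: subset_itvl; rewrite bnd_simp -natr1 mulrDl mul1r lerD2l.
  apply: fine_le.
  - apply: integrable_fin_num => //.
    by apply: integrableS (ip n) => //; exact: measurable_itv.
  - by apply: integrable_fin_num => //; exact: measurable_itv.
  - apply: ge0_subset_integral => //; first exact: measurable_itv.
    + by apply: measurable_funTS; exact/measurable_EFinP.
    + by move=> x _; rewrite lee_fin.
have e0 i : 0 <= e i by have /andP[] := Ee i.
exists (schedule_profile n eps e); first exact: schedule_profile_feasible.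
by rewrite bits_schedule_profile.
Qed.

Lemma S_off_leP (E : nat -> R) (n : nat) :
  (S_off w Ct B0 g E <= n%:R%:E)%E <->
  forall k : nat, exists2 e, schedulable E e &
    B0 <= throughput w g n (w / k.+1%:R) e.
Proof.
rewrite /S_off nb_slots_le// /offline_time.
rewrite (completion_times_le w_gt0 g_rate); last 2 first.
- by move=> p [].
- by move=> p [].
have epsP k : 0 < w / k.+1%:R <= w.
  by rewrite divr_gt0//= ler_pdivrMr// ler_peMr ?ler1n// ltW.
by split => h k; apply/(offline_bitsP _ _ (epsP k)); exact: h.
Qed.

End offline.

(** * Rational schedules and compactness *)

Section schedules.
Context {R : realType}.
Variables (w Ct : R) (g : R -> R).
Hypothesis w_gt0 : 0 < w.
Hypothesis g_rate : rate_function g.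

Lemma le_throughput_scale (n : nat) (eps t : R) (e e' : nat -> R) :
  0 < eps -> 0 <= t <= 1 -> (forall i, 0 <= e i) ->
  (forall i, (i <= n)%N -> t * e i <= e' i) ->
  t * throughput w g n eps e <= throughput w g n eps e'.
Proof.
move=> eps0 t01 e0 ee'; have /andP[t0 _] := t01.
have scale (L : R) i : 0 < L -> (i <= n)%N ->
    t * (L * g (e i / L)) <= L * g (e' i / L).
  move=> L0 ltin; rewrite mulrCA ler_pM2l//.
  have eL : 0 <= e i / L by rewrite divr_ge0// ltW.
  apply: le_trans (rate_scale g_rate t01 eL) _.
  apply: rate_le => //; first by rewrite mulr_ge0.
  by rewrite mulrA ler_pM2r ?invr_gt0// ee'.
rewrite /throughput mulrDr mulr_sumr lerD// ?scale//.
by apply: ler_sum => i _; rewrite scale// ltnW.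
Qed.

(** Approximation factors tending to 1; being at least 1/2, they allow a gap independent of [j]. *)
Let theta (j : nat) : R := 1 - j.+2%:R^-1.

Let theta_itv j : 2^-1 <= theta j < 1.
Proof.
rewrite /theta gtrBl invr_gt0 ltr0n andbT lerBrDr -lerBrDl.
rewrite (_ : 1 - 2^-1 = 2^-1 :> R); last lra.
by rewrite lef_pV2 ?posrE// ler_nat.
Qed.

Let le_theta i j : (i <= j)%N -> theta i <= theta j.
Proof. by move=> ij; rewrite lerB// lef_pV2 ?posrE// ler_nat. Qed.

(** Finite lists form a countable type; the energy past the end of the list is 0. *)
Definition rat_schedule (s : seq rat) (i : nat) : R := ratr (nth 0 s i).

Definition gapped (a : R) (e : nat -> R) := forall i, e i = 0 \/ a <= e i.

(** Each positive energy is lowered to a rational between [theta j * e i] and [e i]. The gap is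
    chosen before [j], as the compactness argument needs one gap for the whole sequence. *)
Lemma rat_schedule_approx (E : nat -> R) (n : nat) (eps : R) (e : nat -> R) :
  0 < eps -> schedulable Ct E e ->
  exists m : nat, forall j : nat, exists s : seq rat,
    [/\ schedulable Ct E (rat_schedule s),
        gapped m.+1%:R^-1 (rat_schedule s) &
        theta j * throughput w g n eps e <= throughput w g n eps (rat_schedule s)].
Proof.
move=> eps0 Ee; have e0 i : 0 <= e i by have /andP[] := Ee i.
(* For [i <= n] and [e i > 0] this gives [m.+1%:R^-1 <= e i / 2 <= theta j * e i]; at [e i = 0] the
   quotient is 0 and adds nothing. *)
pose m := (\max_(i < n.+1) Num.truncn (2 / e i))%N.
exists m => j; have /andP[t12 t1] := theta_itv j.
have t0 : 0 <= theta j by rewrite (le_trans _ t12).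
have /choice[q Hq] : forall i, exists q : rat,
    [/\ 0 <= ratr q :> R, ratr q <= e i, theta j * e i <= ratr q &
      (i <= n)%N -> ratr q = 0 :> R \/ m.+1%:R^-1 <= ratr q :> R].
  move=> i; have := e0 i; rewrite le_eqVlt => /orP[/eqP ei|ei].
    by exists 0; rewrite -ei mulr0 rmorph0 lexx; split => //; left.
  have /(@rat_in_itvoo R)[q] : theta j * e i < e i by rewrite gtr_pMl.
  rewrite in_itv/= => /andP[tq qe]; exists q.
  have q0 : 0 <= ratr q :> R by rewrite (le_trans _ (ltW tq))// mulr_ge0// ltW.
  split => //; try exact: ltW; move=> ltin; right.
  apply: le_trans (ltW tq).
  apply: (@le_trans _ _ (2^-1 * e i)); last by rewrite ler_pM2r.
  have -> : 2^-1 * e i = (2 / e i)^-1 by rewrite invf_div mulrC.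
  rewrite lef_pV2 ?posrE ?divr_gt0//.
  rewrite (le_trans (ltW (truncnS_gt _)))// ler_nat ltnS.
  exact: (leq_bigmax (Ordinal (ltin : (i < n.+1)%N))).
exists (mkseq q n.+1).
have qE i : rat_schedule (mkseq q n.+1) i = if (i <= n)%N then ratr (q i) else 0.
  rewrite /rat_schedule; case: leqP => ni; first by rewrite nth_mkseq.
  by rewrite nth_default ?rmorph0// size_mkseq.
split.
- apply: le_schedulable Ee => i; rewrite qE; case: ifP => _.
    by have [-> ->] := Hq i.
  by rewrite lexx e0.
- move=> i; rewrite qE; case: ifP => [ltin|_]; last by left.
  by have [_ _ _] := Hq i; exact.
- apply: le_throughput_scale => //; first by rewrite t0 ltW.
  by move=> i ltin; rewrite qE ltin; have [] := Hq i.
Qed.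

(** Capping at [Ct] does not enlarge a discrepancy, so each earlier slot contributes at most [d]. *)
Lemma battery_lipschitz (E e e' : nat -> R) (d : R) (i : nat) : 0 <= d ->
  (forall j, (j < i)%N -> e j <= e' j + d) ->
  battery Ct E e' i <= battery Ct E e i + i%:R * d.
Proof.
move=> d0; elim: i => [|i IH] ee' /=; first by rewrite mul0r addr0.
have {}IH := IH (fun j ji => ee' j (ltnW ji)); have := ee' i (ltnSn i).
set x := battery _ _ _ _ in IH *; set y := battery _ _ _ _ in IH * => eie.
rewrite -natr1 mulrDl mul1r -lerBlDr.
have id0 : 0 <= i%:R * d by rewrite mulr_ge0.
have mC : Num.min Ct (x - e' i + E i.+1) <= Ct by rewrite ge_min lexx.
have mx : Num.min Ct (x - e' i + E i.+1) <= x - e' i + E i.+1.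
  by rewrite ge_min lexx orbT.
by rewrite le_min; apply/andP; split; lra.
Qed.

Section compactness.
Import ArrowAsProduct.

Lemma near_coordinates (e : nat -> R) (n : nat) (d : R) : 0 < d ->
  \forall e' \near e, forall i, (i < n)%N -> `|e i - e' i| < d.
Proof.
move=> d0.
have : forall i : 'I_n, \forall e' \near e, `|e i - e' (i : nat)| < d.
  move=> i; have /cvgrPdist_lt := @proj_continuous _ (fun=> R) (i : nat) e.
  by apply.
move=> /filter_forall; apply: filterS => e' H i ltin.
exact: (H (Ordinal ltin)).
Qed.

(* [throughput] is not continuous in the energies, but the gap makes the energies
   vanishing in the limit vanish already near it, and for the others monotonicity
   and [t * g x <= g (t * x)] replace continuity. *)
Lemma throughput_attained (E : nat -> R) (n : nat) (eps a B : R) (u : nat -> nat -> R) :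
  0 < eps -> 0 < a -> 0 <= B ->
  (forall j, [/\ schedulable Ct E (u j), gapped a (u j) &
     theta j * B <= throughput w g n eps (u j)]) ->
  exists2 e, schedulable Ct E e & B <= throughput w g n eps e.
Proof.
move=> eps0 a0 B0 Hu.
have u0 j i : 0 <= u j i by have [/(_ i)/andP[]] := Hu j.
have compact_box : compact [set e : nat -> R | forall i, `[0, Ct]%classic (e i)].
  apply: (@tychonoff nat (fun=> R) (fun=> `[0, Ct]%classic)) => i.
  exact: segment_compact.
(* [e] is a cluster point of the sequence in the compact box. *)
have [|e [box_e eu]] := compact_box (u @ \oo) _.
  exists 0%N => // j _ i /=; rewrite in_itv/= u0.
  have [/(_ i)/andP[_ ui] _ _] := Hu j.
  by rewrite (le_trans ui)// battery_le_capacity.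
have e0 i : 0 <= e i by have := box_e i; rewrite /= in_itv/= => /andP[].
have Ee : schedulable Ct E e.
  move=> i; rewrite e0/=; apply/ler_addgt0Pr => d d0.
  (* The [i] earlier slots and slot [i] itself each cost at most [d / i.+1%:R], hence [d] in
     total. *)
  have d'0 : 0 < d / i.+1%:R by rewrite divr_gt0.
  have [|_ [[j _ <-] ee']] := eu (range u) _ _ (near_coordinates e i.+1 d'0).
    by exists 0%N => // j _; exists j.
  have [/(_ i)/andP[_ ui] _ _] := Hu j.
  have := ee' i (ltnSn i); rewrite ltr_norml => /andP[_ ei].
  have := @battery_lipschitz E e (u j) (d / i.+1%:R) i (ltW d'0).
  have : d = d / i.+1%:R + i%:R * (d / i.+1%:R).
    by rewrite -[X in X + _]mul1r -mulrDl nat1r mulrC divfK.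
  move: (d / i.+1%:R) d'0 ee' ei => d' d'0 ee' ei dE.
  have {}ee' k : (k < i)%N -> e k <= u j k + d'.
    move=> ki; have := ee' k (ltnW ki); rewrite ltr_norml => /andP[_]; lra.
  move=> /(_ ee'); lra.
exists e => //.
(* One factor [theta J] comes from the bound on [u j] with [j >= J], the other from comparing [u j]
   with the limit. *)
have thetaB J : theta J * (theta J * B) <= throughput w g n eps e.
  have /andP[t12 t1] := theta_itv J.
  have t0 : 0 < theta J by rewrite (lt_le_trans _ t12).
  have [||_ [[j Jj ->] /= uj]] := eu [set e' | exists2 j, (J <= j)%N & e' = u j]
    [set e' | forall i : 'I_n.+1, gapped a e' ->
      theta J * e' (i : nat) <= e i].
  - by exists J => // j /= Jj; exists j.
  - suff : forall i : 'I_n.+1, \forall e' \near e,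
        gapped a e' -> theta J * e' (i : nat) <= e i by move=> /filter_forall.
    move=> i; have := e0 i; rewrite le_eqVlt => /orP[/eqP ei0|ei_gt0].
      (* A gapped coordinate closer than [a] to 0 is 0. *)
      apply: filterS (near_coordinates e i.+1 a0) => e' /(_ i (ltnSn i)) + /(_ i).
      by rewrite -ei0 ltr_norml => /andP[e'a _] [->|]; rewrite ?mulr0//; lra.
    (* Within this distance of [e i], the coordinate [e' i] stays below [e i / theta J]. *)
    have d0 : 0 < e i / theta J - e i by rewrite subr_gt0 ltr_pdivlMr// gtr_pMr.
    apply: filterS (near_coordinates e i.+1 d0) => e' /(_ i (ltnSn i)) + _.
    rewrite ltr_norml => /andP[+ _]; rewrite ltrNl opprB ltrBlDr subrK.
    by rewrite ltr_pdivlMr// mulrC => /ltW.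
  - have [_ gj Bj] := Hu j.
    apply: (@le_trans _ _ (theta J * throughput w g n eps (u j))).
      rewrite ler_pM2l// (le_trans _ Bj)// ler_wpM2r//.
      exact: le_theta.
    apply: le_throughput_scale => //; first by rewrite !ltW.
    by move=> i ltin; exact: (uj (Ordinal (ltin : (i < n.+1)%N))).
apply/ler_addgt0Pr => d d0.
(* The product of the two factors is at least [1 - 2 / J.+2%:R], and this [J] makes the loss
   [2 * B / J.+2%:R] at most [d]. *)
pose J := Num.truncn (2 * B / d).
have := thetaB J; rewrite /theta.
have : 2 * B * J.+2%:R^-1 <= d.
  rewrite ler_pdivrMr// (mulrC d) -ler_pdivrMr//.
  by rewrite (le_trans (ltW (truncnS_gt _)))// ler_nat.
set x := J.+2%:R^-1; have : 0 <= x by rewrite invr_ge0.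
nra.
Qed.

End compactness.
End schedules.

(** * Measurability of the offline slot count, and its lower bound *)

Section measurability.
Context {R : realType} {d : measure_display} {T : measurableType d}.
Variables (w Ct B0 : R) (g : R -> R).
Hypothesis w_gt0 : 0 < w.
Hypothesis Ct_gt0 : 0 < Ct.
Hypothesis B0_gt0 : 0 < B0.
Hypothesis g_rate : rate_function g.
Variable E : nat -> T -> R.
Hypothesis mE : forall i, measurable_fun setT (E i).
Local Notation Ew omega := (fun i => E i omega).

Lemma measurable_le_cst (h : T -> R) (x : R) : measurable_fun setT h ->
  measurable [set omega | x <= h omega].
Proof.
move=> mh; have := mh measurableT `[x, +oo[%classic (measurable_itv _).
by rewrite setTI; congr measurable; apply/funext => omega/=; rewrite in_itv/= andbT.
Qed.

Lemma measurable_prop (Q : Prop) : measurable [set _ : T | Q].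
Proof.
have [q|nq] := pselect Q.
  by rewrite (_ : [set _ | Q] = setT)//; apply/seteqP; split.
by rewrite (_ : [set _ | Q] = set0)//; apply/seteqP; split.
Qed.

Lemma measurable_battery (e : nat -> R) (i : nat) :
  measurable_fun setT (fun omega => battery Ct (Ew omega) e i).
Proof.
elim: i => [|i IH] /=; apply: measurable_minr => //.
by apply: measurable_funD => //; exact: measurable_funB.
Qed.

Lemma measurable_schedulable (e : nat -> R) :
  measurable [set omega | schedulable Ct (Ew omega) e].
Proof.
have -> : [set omega | schedulable Ct (Ew omega) e] = \bigcap_i
    ([set _ : T | 0 <= e i] `&` [set omega | e i <= battery Ct (Ew omega) e i]).
  apply/seteqP; split => omega /= He i => [_|]; have := He i.
    by move=> /andP[? ?]; split.
  by move=> /(_ Logic.I)[/= e0 eb]; rewrite e0.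
apply: bigcapT_measurable => i; apply: measurableI; first exact: measurable_prop.
by apply: measurable_le_cst; exact: measurable_battery.
Qed.

(** The existential over real sequences becomes a countable union over gaps, intersection over
    precisions and union over rational lists: approximation gives one inclusion, compactness the
    other. *)
Lemma measurable_exists_schedule (n : nat) (eps B : R) : 0 < eps -> 0 <= B ->
  measurable [set omega | exists2 e, schedulable Ct (Ew omega) e &
                                     B <= throughput w g n eps e].
Proof.
move=> eps0 Bge0; pose good (m j : nat) (s : seq rat) : Prop :=
  gapped (m.+1%:R^-1 : R) (rat_schedule s) /\
  (1 - j.+2%:R^-1) * B <= throughput w g n eps (rat_schedule s : nat -> R).
have -> : [set omega | exists2 e, schedulable Ct (Ew omega) e &
                                  B <= throughput w g n eps e] =
    \bigcup_m \bigcap_j \bigcup_(s : seq rat)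
      ([set omega | schedulable Ct (Ew omega) (rat_schedule s)] `&`
       [set _ : T | good m j s]).
  apply/seteqP; split => omega /=.
    move=> [e Ee Be].
    have [m Hm] := rat_schedule_approx w_gt0 g_rate n eps0 Ee.
    exists m => // j _; have [s [Es gs Bs]] := Hm j; exists s => //.
    split => //; split => //; apply: le_trans Bs.
    by rewrite ler_wpM2l// subr_ge0 invf_le1// ler1n.
  move=> [m _ Hm].
  have /choice[u Hu] : forall j, exists s : seq rat,
      schedulable Ct (Ew omega) (rat_schedule s) /\ good m j s.
    by move=> j; have [s _ []] := Hm j Logic.I; exists s.
  apply: (@throughput_attained _ w Ct g w_gt0 g_rate _ n eps m.+1%:R^-1 B
    (fun j => rat_schedule (u j))) => //.
  by move=> j; have [? []] := Hu j.
apply: bigcupT_measurable => m; apply: bigcapT_measurable => j.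
apply: countable_bigcupT_measurable => // s.
by apply: measurableI; [exact: measurable_schedulable|exact: measurable_prop].
Qed.

(** The slot count is the infimum over [n] of the functions equal to [n] on a measurable event and
    to [+oo] off it. *)
Lemma measurable_nb_slots (t : T -> \bar R) :
  (forall n : nat, measurable [set omega | nb_slots w (t omega) <= n%:R%:E]%E) ->
  measurable_fun setT (fun omega => nb_slots w (t omega)).
Proof.
move=> mt.
pose h n omega : \bar R :=
  if (nb_slots w (t omega) <= n%:R%:E)%E then n%:R%:E else +oo%E.
have -> : (fun omega => nb_slots w (t omega)) = (fun omega => einfs (h^~ omega) 0%N).
  apply/funext => omega; apply/eqP; rewrite eq_le; apply/andP; split.
    apply: le_ereal_inf_tmp => _ [n _ <-]; rewrite /h.
    by case: ifPn => // _; rewrite leey.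
  apply: le_ereal_inf_tmp => _ [n /= tn <-]; apply: ge_ereal_inf.
  exists (h n omega); first by exists n.
  by rewrite /h ifT//; apply: ereal_inf_lbound; exists n.
apply: measurable_fun_einfs => n; apply: measurable_fun_ifT => //.
by apply: (measurable_fun_bool true); rewrite setTI; exact: mt.
Qed.

Lemma measurable_S_off :
  measurable_fun setT (fun omega => S_off w Ct B0 g (Ew omega)).
Proof.
apply: measurable_nb_slots => n.
have -> : [set omega | S_off w Ct B0 g (Ew omega) <= n%:R%:E]%E =
    \bigcap_k [set omega | exists2 e, schedulable Ct (Ew omega) e &
      B0 <= throughput w g n (w / k.+1%:R) e].
  apply/seteqP; split => omega /=.
    by move=> /(S_off_leP Ct B0 w_gt0 g_rate) H k _; exact: H.
  by move=> H; apply/(S_off_leP Ct B0 w_gt0 g_rate) => k; exact: H.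
by apply: bigcapT_measurable => k; apply: measurable_exists_schedule;
  [rewrite divr_gt0|exact: ltW].
Qed.

Lemma S_off_ge1 (A : nat -> R) : (1 <= S_off w Ct B0 g A)%E.
Proof.
apply: le_ereal_inf_tmp => _ [n /= off_n <-].
rewrite lee_fin ler1n lt0n; apply/eqP => n0; move: off_n; rewrite {}n0.
move=> /(nb_slots_le w_gt0)/(S_off_leP Ct B0 w_gt0 g_rate) off0.
(* Once [Ct / eps] exceeds [M], [eps * g (Ct / eps)] is below [B0]; the choice of [k] achieves this
   for [eps = w / k.+1%:R]. *)
have [M [_ HM]] : \forall p \near +oo, `|g p / p| < B0 / Ct.
  have /cvgr0_norm_lt := rate_div_cvg0 g_rate; apply; exact: divr_gt0.
pose k := Num.truncn (M * w / Ct).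
have k0 : 0 < w / k.+1%:R by rewrite divr_gt0.
have [e eA] := off0 k; rewrite /throughput big_ord0 add0r.
set eps := w / _ in k0 *; apply/negP; rewrite -ltNge.
have /andP[e0 eC] := eA 0%N.
have Ceps : M < Ct / eps.
  rewrite ltr_pdivlMr// /eps mulrA ltr_pdivrMr// (mulrC Ct) -ltr_pdivrMr//.
  exact: truncnS_gt.
apply: (@le_lt_trans _ _ (eps * g (Ct / eps))).
  rewrite ler_pM2l//; apply: rate_le => //; first by rewrite divr_ge0// ltW.
  rewrite ler_pM2r ?invr_gt0//.
  exact: le_trans eC (battery_le_capacity _ _ _ _).
have := HM _ Ceps; rewrite ger0_norm; last first.
  by rewrite divr_ge0 ?(rate_ge0 g_rate)// divr_ge0// ltW.
rewrite ltr_pdivlMr//; apply: le_lt_trans.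
by rewrite le_eqVlt; apply/orP; left; apply/eqP; field; rewrite !gt_eqF.
Qed.

End measurability.

(** * Accumulate&Dump: phases, energy accounting and measurability *)

Section online.
Context {R : realType}.
Variables (w Ct B0 c : R) (g : R -> R).
Hypothesis w_gt0 : 0 < w.
Hypothesis Ct_gt0 : 0 < Ct.
Hypothesis B0_gt0 : 0 < B0.
Hypothesis c_ge1 : 1 <= c.
Hypothesis g_rate : rate_function g.

Let c_gt0 : 0 < c. Proof. exact: lt_le_trans c_ge1. Qed.

Let threshold_gt0 : 0 < Ct / c. Proof. exact: divr_gt0. Qed.

Definition phase_sum (E : nat -> R) (i : nat) : R :=
  \sum_(ad_start Ct c E i <= k < i.+1) E k.

Lemma ad_start_le (E : nat -> R) (i : nat) : (ad_start Ct c E i <= i)%N.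
Proof. by elim: i => [|i IH] //=; case: ifP => // _; exact: leqW. Qed.

Lemma phase_sum0 (E : nat -> R) : phase_sum E 0 = E 0%N.
Proof. by rewrite /phase_sum big_nat1. Qed.

(** This recursion hides the varying start of the phase; it carries both the energy accounting and
    the measurability. *)
Lemma phase_sumS (E : nat -> R) (i : nat) : phase_sum E i.+1 =
  (if Ct / c <= phase_sum E i then 0 else phase_sum E i) + E i.+1.
Proof.
rewrite {1}/phase_sum /=; case: ifP => _; first by rewrite big_nat1 add0r.
by rewrite big_nat_recr//= leqW// ad_start_le.
Qed.

Lemma ad_energy_ge0 (E : nat -> R) (i : nat) : 0 <= ad_energy Ct c E i.
Proof.
rewrite /ad_energy; case: ifP => // cs.
by rewrite le_min ltW//= (le_trans _ cs)// ltW.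
Qed.

Lemma measurable_ad_power (E : nat -> R) :
  measurable_fun setT (ad_power w Ct c E).
Proof. exact: (measurable_slotwise w (fun i => ad_energy Ct c E i / w)). Qed.

Lemma ad_power_ge0 (E : nat -> R) (t : R) : 0 <= ad_power w Ct c E t.
Proof. by rewrite divr_ge0 ?ad_energy_ge0// ltW. Qed.

Lemma bits_ad_power (E : nat -> R) (n : nat) (eps : R) : 0 <= eps <= w ->
  bits g (ad_power w Ct c E) (n%:R * w + eps) =
  (\sum_(i < n) w * g (ad_energy Ct c E i / w) +
   eps * g (ad_energy Ct c E n / w))%:E.
Proof.
move=> /andP[eps0 epsw].
apply: (bits_step w_gt0 g_rate (u := fun i => ad_energy Ct c E i / w)) => //.
- exact: measurable_ad_power.
- exact: ad_power_ge0.
- by move=> i t _ it; rewrite /ad_power (truncn_slot w_gt0 it).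
- move=> t /andP[nt tn]; rewrite /ad_power (@truncn_slot _ w w_gt0 n)// nt/=.
  by rewrite -natr1 mulrDl mul1r (lt_le_trans tn)// lerD2l.
Qed.

Lemma S_on_leP (E : nat -> R) (n : nat) :
  (S_on w Ct B0 g c E <= n%:R%:E)%E <->
  forall k : nat, B0 <= \sum_(i < n) w * g (ad_energy Ct c E i / w) +
                        w / k.+1%:R * g (ad_energy Ct c E n / w).
Proof.
rewrite /S_on nb_slots_le//.
have := @completion_times_le _ w w_gt0 g g_rate B0 [set ad_power w Ct c E] n.
rewrite image_set1 ereal_inf1 => ->; last 2 first.
- by move=> _ ->; exact: measurable_ad_power.
- by move=> _ -> t; exact: ad_power_ge0.
have epsP k : 0 <= w / k.+1%:R <= w.
  rewrite ler_pdivrMr// ler_peMr ?ler1n ?andbT//; last exact: ltW.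
  by rewrite divr_ge0// ltW.
split => H k.
  by have [_ ->] := H k; rewrite bits_ad_power// lee_fin.
by exists (ad_power w Ct c E) => //; rewrite bits_ad_power// lee_fin.
Qed.

Lemma S_on_ge0 (E : nat -> R) : (0 <= S_on w Ct B0 g c E)%E.
Proof. by apply: le_ereal_inf_tmp => _ [n _ <-]; rewrite lee_fin. Qed.

(* Each phase delivers at least this many bits. *)
Let phase_bits : R := w * g (Ct / c / w).

Let phase_bits_gt0 : 0 < phase_bits.
Proof. by rewrite mulr_gt0// (rate_gt0 g_rate)// divr_gt0. Qed.

Let slot_bits_ge0 (E : nat -> R) i : 0 <= w * g (ad_energy Ct c E i / w).
Proof.
by rewrite mulr_ge0 ?(ltW w_gt0)// (rate_ge0 g_rate)// divr_ge0 ?ad_energy_ge0// ltW.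
Qed.

(** As [c >= 1], the threshold is at most the capacity, so the cap leaves at least [Ct / c] to
    spend. *)
Let phase_bits_le (E : nat -> R) i : Ct / c <= phase_sum E i ->
  phase_bits <= w * g (ad_energy Ct c E i / w).
Proof.
move=> cs; rewrite ler_pM2l//; apply: rate_le => //; first by rewrite divr_ge0// ltW.
rewrite ler_pM2r ?invr_gt0// /ad_energy -/(phase_sum E i) cs le_min cs andbT.
by rewrite ler_pdivrMr// ler_peMr// ltW.
Qed.

Section bounded_arrivals.
Variable E : nat -> R.
Hypothesis E_itv : forall i, 0 <= E i <= Ct.

(** An ongoing phase holds less than [Ct / c <= Ct] before the arrival in slot [i], which adds at
    most [Ct]. *)
Let phase_sum_le i : phase_sum E i <= 2 * Ct.
Proof.
have le_cap j : E j <= Ct by have /andP[] := E_itv j.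
rewrite mulr_natl mulr2n.
case: i => [|i]; first by rewrite phase_sum0 -[E 0%N]add0r lerD// ltW.
rewrite phase_sumS lerD//; case: ifPn => [_|]; first exact: ltW.
rewrite -ltNge => /ltW/le_trans; apply.
by rewrite ler_pdivrMr// ler_peMr// ltW.
Qed.

(* A phase that ends in slot [i] consumes at most [2 * Ct]. *)
Let energy_le_bits i : phase_bits * \sum_(k < i.+1) E k <=
  2 * Ct * (\sum_(k < i) w * g (ad_energy Ct c E k / w)) +
  phase_bits * phase_sum E i.
Proof.
elim: i => [|i IH].
  by rewrite big_ord1 big_ord0 mulr0 add0r phase_sum0.
rewrite big_ord_recr/= mulrDr.
apply: (le_trans (lerD IH (lexx _))).
rewrite [in leRHS]big_ord_recr/= mulrDr phase_sumS mulrDr addrA lerD2r -!addrA lerD2l.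
(* If a phase ends in slot [i], its pending energy is paid for by the bits of that slot; otherwise
   it is carried over. *)
case: ifPn => cs.
  rewrite mulr0 addr0 mulrC.
  apply: ler_pM => //; last exact: phase_bits_le.
    by rewrite (le_trans _ cs)// ltW.
  exact: ltW.
by rewrite lerDr mulr_ge0// mulr_ge0// ltW.
Qed.

(** The summand 1 pays for the phase containing the last slot, whose bits are not counted. *)
Lemma S_on_le (n : nat) :
  2 * Ct * (B0 / phase_bits + 1) <= \sum_(k < n) E k ->
  (S_on w Ct B0 g c E <= n%:R%:E)%E.
Proof.
have C20 : 0 < 2 * Ct by rewrite mulr_gt0.
case: n => [|n].
  rewrite big_ord0 leNgt mulr_gt0// ltr_wpDl// divr_ge0// ltW//.
move=> En; apply/S_on_leP => k.
have := energy_le_bits n; have := phase_sum_le n.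
rewrite -(ler_pM2l phase_bits_gt0) in En * => sn bn.
have {}bn : 2 * Ct * (B0 + phase_bits) <=
    2 * Ct * (\sum_(k < n) w * g (ad_energy Ct c E k / w)) + phase_bits * (2 * Ct).
  apply: (@le_trans _ _ (phase_bits * (2 * Ct * (B0 / phase_bits + 1)))).
    rewrite le_eqVlt; apply/orP; left; apply/eqP; field.
    by rewrite gt_eqF.
  by rewrite (le_trans En)// (le_trans bn)// lerD2l ler_pM2l.
have {}bn : B0 <= \sum_(k < n) w * g (ad_energy Ct c E k / w).
  rewrite -(ler_pM2l C20) -(lerD2r (phase_bits * (2 * Ct))).
  by apply: le_trans bn; rewrite mulrDr (mulrC phase_bits).
rewrite (le_trans bn)// big_ord_recr/= -addrA lerDl addr_ge0//.
rewrite mulr_ge0 ?divr_ge0 ?(ltW w_gt0)// (rate_ge0 g_rate)//.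
by rewrite divr_ge0 ?ad_energy_ge0// ltW.
Qed.

End bounded_arrivals.

Section measurable_online.
Context {d : measure_display} {T : measurableType d}.
Variable E : nat -> T -> R.
Hypothesis mE : forall i, measurable_fun setT (E i).
Local Notation Ew omega := (fun i => E i omega).

Lemma measurable_phase_sum (i : nat) :
  measurable_fun setT (fun omega => phase_sum (Ew omega) i).
Proof.
elim: i => [|i IH].
  rewrite (_ : (fun omega => _) = E 0%N)//.
  by apply/funext => omega; rewrite phase_sum0.
rewrite (_ : (fun omega => _) = fun omega =>
  (if Ct / c <= phase_sum (Ew omega) i then 0 else phase_sum (Ew omega) i) +
  E i.+1 omega); last by apply/funext => omega; rewrite phase_sumS.
apply: measurable_funD => //; apply: measurable_fun_ifT => //.
exact: measurable_fun_ler.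
Qed.

Lemma measurable_ad_energy (i : nat) :
  measurable_fun setT (fun omega => ad_energy Ct c (Ew omega) i).
Proof.
apply: measurable_fun_ifT => //.
  by apply: measurable_fun_ler => //; exact: measurable_phase_sum.
by apply: measurable_minr => //; exact: measurable_phase_sum.
Qed.

Lemma measurable_S_on :
  measurable_fun setT (fun omega => S_on w Ct B0 g c (Ew omega)).
Proof.
apply: measurable_nb_slots => n.
have mrate i : measurable_fun setT
    (fun omega => g (ad_energy Ct c (Ew omega) i / w)).
  apply: measurable_rate_comp => //.
    by apply: measurable_funM => //; exact: measurable_ad_energy.
  by move=> omega; rewrite divr_ge0 ?ad_energy_ge0// ltW.
have -> : [set omega | S_on w Ct B0 g c (Ew omega) <= n%:R%:E]%E =
    \bigcap_k [set omega | B0 <=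
      \sum_(i < n) w * g (ad_energy Ct c (Ew omega) i / w) +
      w / k.+1%:R * g (ad_energy Ct c (Ew omega) n / w)].
  apply/seteqP; split => omega /=.
    by move=> /S_on_leP H k _; exact: H.
  by move=> H; apply/S_on_leP => k; exact: H.
apply: bigcapT_measurable => k; apply: measurable_le_cst.
apply: measurable_funD; last exact: measurable_funM.
by apply: measurable_sum => i; exact: measurable_funM.
Qed.

End measurable_online.
End online.

(** * Geometric series and a measurable inverse *)

Lemma geometric_partial_sum_le {R : realType} (r : R) (n : nat) : 0 <= r < 1 ->
  \sum_(i < n) r ^+ i <= (1 - r)^-1.
Proof.
move=> /andP[r0 r1]; have r1' : 0 < 1 - r by rewrite subr_gt0.
rewrite -(ler_pM2l r1') divff ?gt_eqF// -[in leLHS]opprB mulNr -subrX1 opprB.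
by rewrite gerBl exprn_ge0.
Qed.

Lemma nneseries_geometric_lty {R : realType} (a r : R) : 0 <= a -> 0 <= r < 1 ->
  (\sum_(0 <= j <oo) (a * r ^+ j)%:E < +oo)%E.
Proof.
move=> a0 r01; have /andP[r0 _] := r01.
have ar0 j : (0 <= (a * r ^+ j)%:E)%E by rewrite lee_fin mulr_ge0// exprn_ge0.
apply: (@le_lt_trans _ _ (a * (1 - r)^-1)%:E); last exact: ltry.
apply: lime_le; first by apply: is_cvg_nneseries => j _ _; exact: ar0.
apply: nearW => n; rewrite sumEFin lee_fin -mulr_sumr ler_wpM2l//.
by rewrite big_mkord; exact: geometric_partial_sum_le.
Qed.

(** Off [+oo], the inverse is a function of [fine (h x)], made monotone on all reals by the cut-off
    at 1. *)
Lemma measurable_inve_ge1 {R : realType} d (T : measurableType d) (h : T -> \bar R) :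
  measurable_fun setT h -> (forall x, 1 <= h x)%E ->
  measurable_fun setT (fun x => (h x)^-1%E).
Proof.
move=> mh h1.
have -> : (fun x => (h x)^-1%E) = (fun x => if h x \in [set +oo%E] then 0%E else
    ((Num.max 1 (fine (h x)))^-1)%:E).
  apply/funext => x; have := h1 x.
  case: (h x) => [r| |] //=; rewrite ?inE.
  - rewrite lee_fin => r1; rewrite memNset// max_r// inver gt_eqF//.
    exact: lt_le_trans r1.
  - by move=> _; rewrite mem_set// invey.
apply: measurable_fun_ifT => //.
  apply: (measurable_fun_bool true).
  rewrite (_ : _ @^-1` _ = h @^-1` [set +oo%E]); first exact: mh.
  by apply/seteqP; split => x /= => [/set_mem|hx]; last exact: mem_set.
apply/measurable_EFinP.
apply: (@measurableT_comp _ _ _ _ _ _ (fun y : R => (Num.max 1 y)^-1)).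
  apply: nonincreasing_measurable => // x y xy.
  rewrite lef_pV2 ?posrE ?lt_max ?ltr01//.
  by rewrite ge_max !le_max lexx xy orbT.
by apply: measurableT_comp => //; exact: fine_measurable.
Qed.

(** * Probability of scarce arrivals *)

Section arrivals.
Context {R : realType} {d : measure_display} {T : measurableType d}.
Variables (P : probability T R) (Ct : R) (f : R -> R).
Hypothesis f_supp : forall x, x < 0 \/ Ct < x -> f x = 0.
Variable E : nat -> {RV P >-> R}.
Hypothesis E_density : forall i, has_density (E i) f.
Hypothesis E_indep : mutually_independent E.

Lemma prob_arrival (i : nat) (A : set R) : measurable A ->
  P (E i @^-1` A) = (\int[@lebesgue_measure R]_(x in A) (f x)%:E)%E.
Proof. by move=> mA; have [_ _ <-] := E_density i. Qed.

Lemma prob_arrival_eq0 (i : nat) (A : set R) : measurable A ->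
  (forall x, A x -> x < 0 \/ Ct < x) -> P (E i @^-1` A) = 0%E.
Proof.
move=> mA As; rewrite prob_arrival//; apply: integral0_eq => x Ax.
by rewrite f_supp//; exact: As.
Qed.

Lemma measurable_arrival (i : nat) (A : set R) : measurable A ->
  measurable (E i @^-1` A).
Proof. by move=> mA; rewrite -[_ @^-1` _]setTI; exact: measurable_funP. Qed.

Lemma ae_arrival_itv : {ae P, forall omega, forall i, 0 <= E i omega <= Ct}.
Proof.
apply: ae_foralln => i.
pose A := `]-oo, 0[%classic `|` `]Ct, +oo[%classic : set R.
have mA : measurable A by apply: measurableU; exact: measurable_itv.
exists (E i @^-1` A); split.
- exact: measurable_arrival.
- apply: prob_arrival_eq0 => // x [] /=; rewrite in_itv/= ?andbT => ?.
    by left.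
  by right.
- move=> omega /= /negP; rewrite negb_and -!ltNge => /orP[?|?]; [left|right];
  by rewrite /= in_itv/= ?andbT.
Qed.

(** The endpoint 0 is Lebesgue-null and [f] vanishes below it. *)
Lemma prob_arrival_le0 (i : nat) : P (E i @^-1` `]-oo, 0]) = 0%E.
Proof.
rewrite prob_arrival; last exact: measurable_itv.
have [mf _ _] := E_density i.
rewrite -integral_itv_bndo_bndc; last first.
  by apply: measurable_funTS; exact/measurable_EFinP.
apply: integral0_eq => x /=; rewrite in_itv/= => x0.
by rewrite f_supp//; left.
Qed.

(** Otherwise every event [E 0 >= n.+1%:R^-1] would be null, and the first arrival nonpositive
    almost surely. The common density makes [rho] the same in all slots. *)
Lemma prob_small_arrival : exists2 delta : R, 0 < delta &
  exists2 rho : R, 0 <= rho < 1 &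
    forall i, P (E i @^-1` `]-oo, delta[) = rho%:E.
Proof.
suff [n Hn] : exists n : nat, (P (E 0%N @^-1` `]-oo, n.+1%:R^-1%R[) < 1)%E.
  have mI : measurable (`]-oo, n.+1%:R^-1%R[%classic : set R) by exact: measurable_itv.
  have fin : P (E 0%N @^-1` `]-oo, n.+1%:R^-1%R[) \is a fin_num.
    by apply: fin_num_measure; exact: measurable_arrival.
  exists n.+1%:R^-1; first by rewrite invr_gt0.
  exists (fine (P (E 0%N @^-1` `]-oo, n.+1%:R^-1%R[))).
    by rewrite fine_ge0//= -lte_fin fineK.
  by move=> i; rewrite fineK// !prob_arrival.
apply: contrapT => /forallNP noN.
have : P setT = 0%E.
  apply: measure_negligible => //.
  apply: (@negligibleS _ _ _ _ (E 0%N @^-1` `]-oo, 0] `|`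
      \bigcup_n (E 0%N @^-1` `[n.+1%:R^-1%R, +oo[))).
    move=> omega _; have [E0|E0] := leP (E 0%N omega) 0.
      by left; rewrite /= in_itv.
    right; exists (Num.truncn (E 0%N omega)^-1) => //=; rewrite in_itv/= andbT.
    rewrite -[leRHS]invrK lef_pV2 ?posrE ?invr_gt0//.
    exact/ltW/truncnS_gt.
  apply: negligibleU.
    exists (E 0%N @^-1` `]-oo, 0]); split => //; last exact: prob_arrival_le0.
    by apply: measurable_arrival; exact: measurable_itv.
  apply: negligible_bigcup => n.
  have mI : measurable (E 0%N @^-1` `]-oo, n.+1%:R^-1%R[).
    by apply: measurable_arrival; exact: measurable_itv.
  have mI' : measurable (E 0%N @^-1` `[n.+1%:R^-1%R, +oo[).
    by apply: measurable_arrival; exact: measurable_itv.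
  exists (E 0%N @^-1` `[n.+1%:R^-1%R, +oo[); split => //.
  have -> : E 0%N @^-1` `[n.+1%:R^-1%R, +oo[ = ~` (E 0%N @^-1` `]-oo, n.+1%:R^-1%R[).
    apply/seteqP; split => omega /=; rewrite !in_itv/= andbT.
      by move=> nE; apply/negP; rewrite -leNgt.
    by move=> /negP; rewrite -leNgt.
  apply: (etrans (probability_setC P mI)).
  have -> : P (E 0%N @^-1` `]-oo, n.+1%:R^-1%R[) = 1%E.
    apply/eqP; rewrite eq_le probability_le1//= leNgt.
    by apply/negP; exact: noN.
  by rewrite subee.
by rewrite probability_setT => /eqP; rewrite onee_eq0.
Qed.

(** For [r < K], these are the slots congruent to [r] modulo [K] in the first [j] rows of length
    [K]. *)
Definition column (K r j : nat) : seq nat := [seq (i * K + r)%N | i <- iota 0 j].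

Definition column_below (K : nat) (delta : R) (j r : nat) : set T :=
  \bigcap_(k in [set` column K r j]) (E k @^-1` `]-oo, delta[).

Lemma measurable_column_below (K : nat) (delta : R) (j r : nat) :
  measurable (column_below K delta j r).
Proof.
apply: bigcap_measurableType => k _.
by apply: measurable_arrival; exact: measurable_itv.
Qed.

(* Some residue class mod [K] has only arrivals below [delta] before slot [j * K]. *)
Definition scarce (K : nat) (delta : R) (j : nat) : set T :=
  \big[setU/set0]_(r < K) column_below K delta j r.

Lemma measurable_scarce (K : nat) (delta : R) (j : nat) :
  measurable (scarce K delta j).
Proof.
by apply: bigsetU_measurable => r _; exact: measurable_column_below.
Qed.

(** Union bound over the [K] columns; the [j] slots of a column are distinct, so independence gives
    [rho ^+ j]. *)
Lemma prob_scarce (K : nat) (delta rho : R) (j : nat) : (0 < K)%N ->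
  (forall i, P (E i @^-1` `]-oo, delta[) = rho%:E) ->
  (P (scarce K delta j) <= (K%:R * rho ^+ j)%:E)%E.
Proof.
move=> K0 Erho.
apply: le_trans (Boole_inequality P (A := column_below K delta j) _) _.
  by move=> r _; exact: measurable_column_below.
rewrite (eq_bigr (fun=> (rho ^+ j)%:E)); last first.
  move=> r _.
  have uniq_column : uniq (column K r j).
    rewrite map_inj_uniq ?iota_uniq// => x y /addIn/eqP.
    by rewrite eqn_pmul2r// => /eqP.
  have mI : measurable (`]-oo, delta[%classic : set R) by exact: measurable_itv.
  apply: (etrans (E_indep (A := fun=> `]-oo, delta[%classic) uniq_column (fun=> mI))).
  rewrite (eq_bigr (fun=> rho%:E)); last by move=> k _; exact: Erho.
  rewrite big_map; elim: j {uniq_column} => [|j IH]; first by rewrite big_nil expr0.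
  by rewrite -addn1 iotaD big_cat/= IH big_seq1 addn1 exprSr EFinM.
by rewrite sumEFin lee_fin sumr_const card_ord mulr_natl.
Qed.

(** Each of the [K] columns contains an arrival of at least [delta]; exchanging the sums over rows
    and columns collects them. *)
Lemma sum_arrivals_ge (K : nat) (delta : R) (j : nat) (omega : T) :
  (forall i, 0 <= E i omega) -> ~ scarce K delta j omega ->
  K%:R * delta <= \sum_(k < j * K) E k omega.
Proof.
move=> E0 nsc.
have col r : (r < K)%N -> delta <= \sum_(i < j) E (i * K + r)%N omega.
  move=> rK; have [i ij Ei] : exists2 i, (i < j)%N & delta <= E (i * K + r)%N omega.
    apply: contrapT => noi; apply: nsc.
    rewrite /scarce -(bigcup_mkord K (column_below K delta j)).
    exists r => // k /= /mapP[i]; rewrite mem_iota/= add0n => ij ->.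
    rewrite in_itv/= ltNge; apply/negP => Ei; apply: noi; by exists i.
  rewrite (bigD1 (Ordinal ij))//= (le_trans Ei)// lerDl sumr_ge0//.
rewrite -(big_mkord xpredT (fun k => E k omega)) big_nat_mul big_mkord.
have -> : \sum_(i < j) \sum_(i * K <= k < i.+1 * K) E k omega =
    \sum_(i < j) \sum_(r < K) E (i * K + r)%N omega.
  apply: eq_bigr => i _; rewrite -{1}[(i * K)%N]add0n big_addn mulSn addnK big_mkord.
  by apply: eq_bigr => r _; rewrite addnC.
rewrite exchange_big/= mulr_natl -[X in _ *+ X]card_ord -sumr_const.
by apply: ler_sum => r _; exact: col.
Qed.

End arrivals.

Theorem theorem6 (R : realType) (d : measure_display) (T : measurableType d)
    (P : probability T R)
    (w Ct B0 c : R) (w_gt0 : 0 < w) (Ct_gt0 : 0 < Ct) (B0_gt0 : 0 < B0)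
    (c_ge1 : 1 <= c)
    (g : R -> R) (g_rate : rate_function g)
    (f : R -> R) (f_supp : forall x, x < 0 \/ Ct < x -> f x = 0)
    (E : nat -> {RV P >-> R})
    (E_density : forall i, has_density (E i) f)
    (E_indep : mutually_independent E) :
  P.-integrable setT
    (fun omega : T =>
       (S_on w Ct B0 g c (fun i => E i omega) /
        S_off w Ct B0 g (fun i => E i omega))%E).
Proof.
pose on omega := S_on w Ct B0 g c (fun i => E i omega).
pose off omega := S_off w Ct B0 g (fun i => E i omega).
have mE i : measurable_fun setT (E i : T -> R) by exact: measurable_funP.
have on0 omega : (0 <= on omega)%E by exact: S_on_ge0.
have off1 omega : (1 <= off omega)%E by exact: S_off_ge1.
have off0 omega : (0 <= (off omega)^-1)%E.
  by rewrite inve_ge0; exact: le_trans (off1 omega).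
have ratio_le omega : (on omega / off omega <= on omega)%E.
  rewrite -[leRHS]mule1; apply: lee_wpmul2l => //.
  rewrite inve_ple ?inE ?lee01//; first by rewrite inve1.
  exact: le_trans (off1 omega).
have mratio : measurable_fun setT (fun omega => on omega / off omega)%E.
  apply: emeasurable_funM; first exact: measurable_S_on.
  by apply: measurable_inve_ge1 => //; exact: measurable_S_off.
have [delta delta0 [rho rho01 Prho]] := prob_small_arrival f_supp E_density.
(* [M] is the energy that suffices online by [S_on_le], and [K] arrivals of size [delta] provide
   it. *)
pose M := 2 * Ct * (B0 / (w * g (Ct / c / w)) + 1).
pose K := (Num.truncn (M / delta)).+1.
have MK : M <= K%:R * delta by rewrite -ler_pdivrMr// ltW// truncnS_gt.
(* [h] adds [K] for each scarce [j]. If [n] is the least index that is not scarce, then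
   [h >= n * K], while [M] has arrived before slot [n * K] and hence [S_on <= n * K]. *)
pose h omega : \bar R :=
  (\sum_(0 <= j <oo) (K%:R * \1_(scarce E K delta j) omega)%:E)%E.
have term0 j omega : (0 <= (K%:R * \1_(scarce E K delta j) omega)%:E)%E.
  by rewrite lee_fin mulr_ge0.
have mterm j : measurable_fun setT
    (fun omega => (K%:R * \1_(scarce E K delta j) omega)%:E).
  apply/measurable_EFinP; apply: measurable_funM => //.
  by apply: measurable_indic; exact: measurable_scarce.
have mh : measurable_fun setT h by exact: ge0_emeasurable_sum.
have h0 omega : (0 <= h omega)%E by exact: nneseries_ge0.
have h_ge n omega : (forall j, (j < n)%N -> scarce E K delta j omega) ->
    ((n * K)%:R%:E <= h omega)%E.
  move=> sc; rewrite /h.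
  apply: (le_trans _ (nneseries_lim_ge n _)); last by move=> j _ _; exact: term0.
  rewrite sumEFin lee_fin big_mkord (eq_bigr (fun=> K%:R)); last first.
    by move=> j _; rewrite indicE mem_set ?mulr1//; exact: sc.
  by rewrite sumr_const card_ord -mulrnA mulnC.
(* The comparison holds only almost everywhere, since the arrivals lie in [[0, Ct]] only almost
   surely. *)
have on_le_h : {ae P, forall omega, setT omega -> (on omega <= h omega)%E}.
  apply: filterS (ae_arrival_itv f_supp E_density) => omega E_itv _.
  have [all_scarce|] := pselect (forall j, scarce E K delta j omega).
    suff -> : h omega = +oo%E by rewrite leey.
    apply/eqyP => A A0; apply: (le_trans _ (h_ge (Num.truncn A).+1 omega _)) => //.
    rewrite lee_fin (le_trans (ltW (truncnS_gt _)))// ler_nat.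
    by rewrite leq_pmulr.
  move=> /existsNP ex_plenty.
  have [n /asboolP nsc minn] := @ex_minnP (fun j => `[< ~ scarce E K delta j omega >])
    (let: ex_intro j nj := ex_plenty in ex_intro _ j (asboolT nj)).
  apply: (le_trans _ (h_ge n omega _)); last first.
    move=> j jn; apply: contrapT => /asboolP /minn.
    by rewrite leqNgt jn.
  apply: S_on_le => //; apply: (le_trans MK).
  by apply: sum_arrivals_ge => // i; have /andP[] := E_itv i.
apply/integrableP; split => //.
apply: (@le_lt_trans _ _ (\int[P]_omega h omega)%E).
  apply: ae_ge0_le_integral => //.
  - exact: measurableT_comp.
  - apply: filterS on_le_h => omega on_h _.
    rewrite gee0_abs; last exact: mule_ge0 (on0 omega) (off0 omega).
    exact: le_trans (ratio_le omega) (on_h Logic.I).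
have -> : (\int[P]_omega h omega = \sum_(0 <= j <oo)
    \int[P]_omega (K%:R * \1_(scarce E K delta j) omega)%:E)%E.
  exact: integral_nneseries.
(* Each term integrates to [K] times the probability of scarcity, so to at most
   [K * K * rho ^ j]. *)
apply: (le_lt_trans _ (nneseries_geometric_lty (a := K%:R * K%:R) _ rho01)); last first.
  by rewrite mulr_ge0.
apply: lee_nneseries => [j _ _|j _]; first exact: integral_ge0.
under eq_integral do rewrite EFinM.
rewrite ge0_integralZl_EFin//; last first.
  by apply/measurable_EFinP; apply: measurable_indic; exact: measurable_scarce.
rewrite integral_indic//; last exact: measurable_scarce.
rewrite setIT -mulrA EFinM; apply: lee_wpmul2l; first by rewrite lee_fin.
exact: (prob_scarce E_indep).
Qed.
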